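(* Suppose that $1 \leq n < \omega$, $\lambda$ is a cardinal, and $\mathcal{C}$ is a coherent $n$-$C$-sequence on $\lambda$. Let $\mathrm{resh}_n$ be the function derived from performing $n$-dimensional walks along $\mathcal{C}$. Then the $n$-family \[ \Phi(\mathrm{resh}_n) = \left\langle \mathrm{resh}_n(\cdot,\vec{\gamma}) : \gamma_0 \rightarrow \bigoplus_{[\lambda]^{n-1}} \mathbb{Z} \ \middle| \ \vec{\gamma} \in [\lambda]^n \right\rangle \] is coherent modulo locally semi-constant functions, i.e., for every $\vec{\delta} \in [\lambda]^{n+1}$, the function $\sum_{i \leq n} (-1)^i \mathrm{resh}_n(\cdot,\vec{\delta}^i)$ (with domain $\delta_0$) is locally semi-constant: for every limit ordinal $\alpha \leq \delta_0$ there is $\eta < \alpha$ such that this function is constant on $(\eta,\alpha)$.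
   Context: Notation: for a set of ordinals $A$, $\mathrm{acc}(A) = \{\beta \in A \mid \sup(A\cap\beta)=\beta>0\}$ and $\mathrm{nacc}(A) = A\setminus\mathrm{acc}(A)$; $D$ is club in an ordinal $\delta$ if $\sup\{\alpha+1 \mid \alpha\in D\}=\delta$ and every $\beta<\delta$ with $\sup(D\cap\beta)=\beta>0$ lies in $D$. $[\lambda]^n$ is identified with strictly increasing $n$-sequences, $\lambda^{[n]}$ denotes weakly increasing $n$-sequences, and for a sequence $\vec{\gamma}$, $\vec{\gamma}^i$ is $\vec{\gamma}$ with its $i$-th entry $\gamma_i$ removed. For an index set $I$, $\bigoplus_I\mathbb{Z}$ is the free abelian group on $I$ and $\lfloor e\rfloor$ is the basis element for $e\in I$. An $n$-$C$-sequence on $\lambda$ is a system $\mathcal{C} = \langle C_{\vec{\gamma}} \mid \vec{\gamma}\in I(\mathcal{C})\rangle$ with $I(\mathcal{C})\subseteq[\lambda]^{\leq n}$, $\emptyset\in I(\mathcal{C})$, $C_\emptyset=\lambda$, and: $\langle\beta\rangle^\frown\vec{\gamma}\in I(\mathcal{C})$ iff $\vec{\gamma}\in I(\mathcal{C})$ and $\beta\in C_{\vec{\gamma}}$, in which case $C_{\beta\vec{\gamma}}$ is club in $\beta\cap C_{\vec{\gamma}}$ (and empty if $\beta\cap C_{\vec{\gamma}}=\emptyset$). It is assumed minimal at successors: if $\beta\in\mathrm{nacc}(C_{\vec{\gamma}})$ then $C_{\beta\vec{\gamma}}=\{\max(C_{\vec{\gamma}}\cap\beta)\}$ (or $\emptyset$).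 Let $X(\mathcal{C})$ be the set of $\alpha$ such that $\alpha\in\mathrm{acc}(C_{\vec{\gamma}})$ for some $\vec{\gamma}\in I(\mathcal{C})\cap[\lambda]^n$. $\mathcal{C}$ is coherent if for all $\alpha\in X(\mathcal{C})$: (i) $C_{\vec{\gamma}}\cap\alpha=C_\alpha$ whenever $\vec{\gamma}\in I(\mathcal{C})\cap[\lambda]^n$ and $\alpha\in\mathrm{acc}(C_{\vec{\gamma}})$; (ii) $C_{\vec{\beta}}=C_\alpha$ whenever $\vec{\beta}\in I(\mathcal{C})$, $\beta_0=\alpha$ and $\sup(C_{\vec{\beta}})=\alpha$. Walks: for $\vec{\beta}\in\lambda^{[n+1]}$ write $\vec{\beta}=\iota(\vec{\beta})^\frown\tau(\vec{\beta})$ where $\tau(\vec{\beta})$ is the longest final segment of $\vec{\beta}$ lying in $I(\mathcal{C})$. For $(\alpha,\vec{\gamma})\in\lambda^{[n+1]}$, the signed upper trace $\mathrm{Tr}_n(+,\alpha,\vec{\gamma})$ is a labelling of a finite tree $S_n(\alpha,\vec{\gamma})\subseteq{}^{<\omega}n$ by elements of $\{-1,1\}\times\lambda^{[n+1]}$, defined recursively: the root $\emptyset$ gets label $(+1,\alpha,\vec{\gamma})$. If node $x$ has label $((-1)^m,\vec{\beta})$ (with $\beta_0=\alpha$), let $j+1=|\iota(\vec{\beta})|$. If $C_{\tau(\vec{\beta})}\setminus\beta_j=\emptyset$, then $x$ is terminal. Otherwise, letting $\nu=\min(C_{\tau(\vec{\beta})}\setminus\beta_j)$ and $\langle\ell_i\mid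 i<n\rangle$ the increasing enumeration of $\{1,\dots,n+1\}\setminus\{j+1\}$, each $x^\frown\langle i\rangle$ ($i<n$) is in the tree with label $((-1)^{m+j+\ell_i}, (\iota(\vec{\beta}),\nu,\tau(\vec{\beta}))^{\ell_i})$, where the superscript $\ell_i$ means deleting the entry in position $\ell_i$ of this length-$(n+2)$ sequence. Then $\mathrm{resh}_n(\alpha,\vec{\gamma})=\sum_{x\in S_n(\alpha,\vec{\gamma})}\varepsilon_x\lfloor\vec{\zeta}_x\rfloor\in\bigoplus_{\lambda^{[n-1]}}\mathbb{Z}$, where $\varepsilon_x\in\{-1,1\}$ is the sign of the label of $x$ and $\vec{\zeta}_x$ is its ordinal part with the first two ordinal coordinates deleted; for $(\alpha,\vec{\gamma})$ with $\vec{\gamma}\in[\lambda]^n$ its values lie in $\bigoplus_{[\lambda]^{n-1}}\mathbb{Z}$. *)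

(* Defs.v *)
From HB Require Import structures.
From mathcomp Require Import all_boot all_order all_algebra.
From mathcomp Require Import boolp classical_sets functions cardinality fsbigop.
From mathcomp Require Import set_interval.
From mathcomp Require Import freeg zify.

Set Implicit Arguments.
Unset Strict Implicit.
Unset Printing Implicit Defensive.
Import Order.TTheory GRing.Theory Num.Theory.
Local Open Scope classical_set_scope.
Local Open Scope card_scope.
Local Open Scope ring_scope.

(* A cardinal lambda is represented by a well-ordered type L of order type
   lambda: the ordinals below lambda are the elements of L, and the ordinal
   [b : L], as a set of ordinals, is the initial segment `]-oo, b[.  Every
   ordinal occurring below is less than lambda, except lambda itself, which is
   [set: L].  As lambda is an initial ordinal, L does not inject into any of its
   proper initial segments. *)
Definition is_cardinal (d : Order.disp_t) (L : orderType d) : Prop :=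
  well_founded (fun x y : L => (x < y)%O) /\
  forall b : L, ~ ([set: L] #<= [set x : L | (x < b)%O]).

Section Ordinals.
Context {d : Order.disp_t} {L : orderType d}.
Implicit Types (A D : set L) (a b x : L).

(* [supremums] takes suprema within lambda; in particular the supremum of the
   empty set is 0. *)
Definition acc A : set L :=
  [set b | [/\ A b, supremums (A `&` `]-oo, b[) b & exists x, (x < b)%O]].

Definition nacc A : set L := A `\` acc A.

Definition limit_ordinal b : Prop := acc setT b.

Definition strict_ubound A : set L := [set b | forall a, A a -> (a < b)%O].

(* [D] is club in [A].  The condition on strict upper bounds says that
   sup {x + 1 | x in D} = sup {x + 1 | x in A}, both suprema being at most
   lambda.  In the last condition, the existence of [a] says that b is less than
   this supremum.  For A an ordinal this is the usual notion of a club subset of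
   an ordinal. *)
Definition club_in D A : Prop :=
  [/\ D `<=` A,
      strict_ubound D = strict_ubound A &
      forall b, (exists2 a, A a & (b <= a)%O) -> (exists x, (x < b)%O) ->
        supremums (D `&` `]-oo, b[) b -> D b].

(* The singleton of the maximum of [A] if there is one, and empty otherwise. *)
Definition maximums A : set L := A `&` ubound A.

Definition least A : option L :=
  if pselect (exists x, (A `&` lbound A) x) is left h
  then Some (projT1 (cid h)) else None.

(* [lambda]^m *)
Definition incseq (m : nat) : set (seq L) :=
  [set s | size s = m /\ sorted <%O s].

(* s^l *)
Definition del (T : Type) (l : nat) (s : seq T) : seq T :=
  take l s ++ drop l.+1 s.

End Ordinals.

Section Walks.
Context {d : Order.disp_t} {L : orderType d} {n : nat}.
Implicit Types (a b x : L) (g s : seq L).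

(* n-C-sequences, minimal at successors.  [Cseq g] is relevant only for
   [g] in [Cidx]; sequences of the form b^g are indexed only if their length is
   at most n. *)
Record nCseq := NCseq {
  Cidx : set (seq L);
  Cseq : seq L -> set L;
  Cidx_inc : forall g, Cidx g -> (size g <= n)%N /\ incseq (size g) g;
  Cidx_nil : Cidx [::];
  Cseq_nil : Cseq [::] = setT;
  Cidx_cons : forall b g, (size g < n)%N ->
    Cidx (b :: g) <-> Cidx g /\ Cseq g b;
  Cseq_club : forall b g, Cidx (b :: g) ->
    club_in (Cseq (b :: g)) (Cseq g `&` `]-oo, b[);
  Cseq_succ : forall b g, Cidx (b :: g) -> nacc (Cseq g) b ->
    Cseq (b :: g) = maximums (Cseq g `&` `]-oo, b[) }.

Variable C : nCseq.

Definition CX : set L :=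
  [set a | exists g, [/\ Cidx C g, size g = n & acc (Cseq C g) a]].

Definition coherent : Prop := forall a, CX a ->
  (forall g, Cidx C g -> size g = n -> acc (Cseq C g) a ->
     Cseq C g `&` `]-oo, a[ = Cseq C [:: a]) /\
  (forall g, Cidx C (a :: g) -> supremums (Cseq C (a :: g)) a ->
     Cseq C (a :: g) = Cseq C [:: a]).

(* s = take (cut s) s ++ drop (cut s) s is the decomposition of s into
   iota(s) and tau(s). *)
Definition cut s : nat :=
  find (fun k => `[< Cidx C (drop k s) >]) (iota 0 (size s).+1).

(* The label of the i-th child of a node labelled (e, s), [None] if this node
   is terminal.  The entry s_j is the last one of iota(s); the default value [a]
   of [last] plays no role.  The sequence [fun i => (bump j i).+1] is the
   increasing enumeration of {1, ..., n + 1} \ {j + 1}. *)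
Definition child (a : L) (i : nat) (p : int * seq L) : option (int * seq L) :=
  let: (e, s) := p in
  let io := take (cut s) s in
  let tau := drop (cut s) s in
  let j := (cut s).-1 in
  let l := (bump j i).+1 in
  if least (Cseq C tau `\` `]-oo, last a io[) is Some nu
  then Some (e * (-1) ^+ (j + l), del l (io ++ nu :: tau)) else None.

(* The label in the signed upper trace Tr_n(+, a, g) of the node x of the n-ary
   tree, [None] if x is not in S_n(a, g). *)
Definition Tr (a : L) (g : seq L) (x : seq 'I_n) : option (int * seq L) :=
  foldl (fun o (i : 'I_n) => obind (child a i) o) (Some (1, a :: g)) x.

Definition Snode (a : L) (g : seq L) : set (seq 'I_n) :=
  [set x | Tr a g x != None].

(* resh_n(a, g).  The sum is a genuine finite sum, by [finite_Snode] below. *)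
Definition resh (a : L) (g : seq L) : {freeg (seq L) / int} :=
  \sum_(x \in Snode a g)
    (if Tr a g x is Some (e, s) then << e *g drop 2 s >> else 0).

End Walks.

Arguments nCseq {d} L n.

(* Phi(resh_n), a family indexed by [lambda]^n *)
Definition Phi_resh (d : Order.disp_t) (L : orderType d) (n : nat)
    (C : nCseq L n) (g : seq L) : L -> {freeg (seq L) / int} :=
  fun a => resh C a g.

Section Families.
Context {d : Order.disp_t} {L : orderType d}.
Implicit Types (Phi : seq L -> L -> {freeg (seq L) / int}) (g : seq L).

(* Phi g maps g_0 to the free abelian group on [lambda]^(n-1), identified with
   the subgroup of {freeg (seq L) / int} of the elements supported by it. *)
Definition n_family (n : nat) Phi : Prop :=
  forall (g0 : L) g, incseq n (g0 :: g) -> forall a, (a < g0)%O ->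
    forall s, s \in dom (Phi (g0 :: g) a) -> incseq n.-1 s.

(* for f with domain the ordinal b *)
Definition locally_semi_constant (T : Type) (b : L) (f : L -> T) : Prop :=
  forall a, limit_ordinal a -> (a <= b)%O ->
    exists2 eta, (eta < a)%O &
      forall x y, (eta < x < a)%O -> (eta < y < a)%O -> f x = f y.

Definition coherent_mod_lsc (n : nat) Phi : Prop :=
  forall (d0 : L) g, incseq n.+1 (d0 :: g) ->
    locally_semi_constant d0
      (fun a => \sum_(i < n.+1) Phi (del i (d0 :: g)) a *~ (-1) ^+ i).

End Families.

Section Finiteness.
Context {d : Order.disp_t} {L : orderType d} {n : nat}.
Implicit Types (a b x : L) (g s : seq L).
Variable C : nCseq L n.

Lemma Cidx_tail b g : Cidx C (b :: g) -> Cidx C g /\ Cseq C g b.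
Proof.
move=> Ig; have [szg _] := Cidx_inc Ig.
by have [/(_ Ig)] := Cidx_cons C b szg.
Qed.

Lemma Cidx_suffix s g : Cidx C (s ++ g) -> Cidx C g.
Proof. by elim: s => //= b s IH /Cidx_tail[/IH]. Qed.

Lemma Cseq_sub b g x :
  Cidx C (b :: g) -> Cseq C (b :: g) x -> Cseq C g x /\ (x < b)%O.
Proof. by move=> /Cseq_club[sub _ _] /sub[gx]; rewrite /= in_itv. Qed.

Lemma Cidx_last s b g nu : Cidx C (s ++ b :: g) -> Cseq C (s ++ b :: g) nu ->
  (last nu s < b)%O /\ Cidx C (last nu s :: g).
Proof.
elim: s nu => [|c s IH] nu /= Ig Cnu.
  have [gnu lt_nu] := Cseq_sub Ig Cnu; split=> //.
  have [szg _] := Cidx_inc Ig; apply/(Cidx_cons C _ szg).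
  by split=> //; have [] := Cidx_tail Ig.
by have [Is Cc] := Cidx_tail Ig; exact: IH.
Qed.

Lemma Cidx_cut s : Cidx C (drop (cut C s) s) /\ (cut C s <= size s)%N.
Proof.
have h : has (fun k => `[< Cidx C (drop k s) >]) (iota 0 (size s).+1).
  apply/hasP; exists (size s); first by rewrite mem_iota /= add0n ltnS.
  by apply/asboolP; rewrite drop_size; exact: Cidx_nil.
have lt_cut : (cut C s < (size s).+1)%N.
  by have := h; rewrite has_find size_iota.
split=> //; apply/asboolP.
by have := nth_find 0%N h; rewrite nth_iota.
Qed.

Lemma cut_suffix s g : Cidx C g -> exists t, drop (cut C (s ++ g)) (s ++ g) = t ++ g.
Proof.
move=> Ig; have le_cut : (cut C (s ++ g) <= size s)%N.
  rewrite leqNgt; apply/negP => lt_cut.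
  have := before_find 0%N lt_cut.
  rewrite nth_iota ?add0n ?drop_size_cat //; last by rewrite size_cat ltnS leq_addr.
  by move/asboolP.
exists (drop (cut C (s ++ g)) s); rewrite drop_cat.
case: ltnP => // le_s; have -> : cut C (s ++ g) = size s by apply/eqP; rewrite eqn_leq le_cut.
by rewrite subnn drop0 drop_size.
Qed.

Lemma cut_gt0 s : size s = n.+1 -> (0 < cut C s)%N.
Proof.
move=> szs; have [+ _] := Cidx_cut s; case: (cut C s) => // /[!drop0] /Cidx_inc[].
by rewrite szs ltnn.
Qed.

(* The child s' of s, with tau(s) = tau, either results from a deletion in
   iota(s), and ends with nu^tau, or results from the deletion of an element b of
   tau, in which case it ends with an index c^w where tau = q^b^w and c < b. *)
Lemma childP a i e s e' s' : (i < n)%N -> size s = n.+1 ->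
  child C a i (e, s) = Some (e', s') ->
  size s' = n.+1 /\
  let tau := drop (cut C s) s in
  (exists p nu, s' = p ++ nu :: tau /\ Cidx C (nu :: tau)) \/
  (exists p q b w (c : L),
     [/\ s' = p ++ c :: w, tau = q ++ b :: w, (c < b)%O & Cidx C (c :: w)]).
Proof.
move=> lt_in szs; rewrite /child; have := cut_gt0 szs; have [] := Cidx_cut s.
have := size_drop (cut C s) s; have := @size_takel (cut C s) L s.
move: (cut C s) (drop _ _) (take _ _) => k tau io sz_io sz_tau Itau le_k k_gt0.
rewrite /least; case: pselect => // h; case: (cid h) => nu /= [[Cnu _] _] [_ <-].
move: {sz_io h}(sz_io le_k) => sz_io; rewrite szs in sz_tau le_k.
set l := (bump k.-1 i).+1.
have lt_l : (l <= n.+1)%N by rewrite /l /bump; lia.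
have neq_l : l != k by rewrite /l /bump; lia.
split; first by rewrite size_cat size_drop size_takel size_cat /=; lia.
rewrite /del take_cat drop_cat sz_io.
have [lt_lk|le_kl] := ltnP l k.
  left; exists (take l io ++ drop l.+1 io), nu; split; last first.
    by apply/(Cidx_cons C _ _) => //; lia.
  rewrite -catA; congr (_ ++ _); case: ltnP => // le_kl.
  have -> : (l.+1 - k = 0)%N by lia.
  by rewrite drop0 drop_oversize ?sz_io.
right; rewrite ltnNge leqW //=; set m := (l - k.+1)%N.
have -> : (l - k = m.+1)%N by rewrite /m; lia.
have -> : (l.+1 - k = m.+2)%N by rewrite /m; lia.
have lt_m : (m < size tau)%N by rewrite /m; lia.
have def_tau : tau = take m tau ++ nth nu tau m :: drop m.+1 tau.
  by rewrite -drop_nth // cat_take_drop.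
have [lt_c Ic] : (last nu (take m tau) < nth nu tau m)%O /\
    Cidx C (last nu (take m tau) :: drop m.+1 tau).
  by apply: Cidx_last; rewrite -def_tau.
exists (io ++ belast nu (take m tau)), (take m tau), (nth nu tau m), (drop m.+1 tau),
  (last nu (take m tau)); split=> //=.
by rewrite -!catA -cat_rcons -lastI.
Qed.

(* Induction along the walks: the relation "child of" is well-founded. *)
Lemma walk_ind (a : L) (P : seq L -> Prop) :
  well_founded (fun x y : L => (x < y)%O) ->
  (forall s, size s = n.+1 ->
    (forall i e e' s', (i < n)%N -> child C a i (e, s) = Some (e', s') -> P s') ->
    P s) ->
  forall s, size s = n.+1 -> P s.
Proof.
move=> wfL Pstep.
suff main r u : (size u + r = n.+1)%N -> Cidx C u ->
    (forall q b w (c : L) p, u = q ++ b :: w -> (c < b)%O -> Cidx C (c :: w) ->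
       size (p ++ c :: w) = n.+1 -> P (p ++ c :: w)) ->
    forall p, size (p ++ u) = n.+1 -> P (p ++ u).
  move=> s szs; rewrite -(cats0 s); apply: (main n.+1) => //; first exact: Cidx_nil.
    by move=> [].
  by rewrite cats0.
elim: r u => [|r IH] u szu Iu Hu.
  by have [] := Cidx_inc Iu; rewrite -[size u]addn0 szu ltnn.
have Hnu nu : Cidx C (nu :: u) ->
    forall p, size (p ++ nu :: u) = n.+1 -> P (p ++ nu :: u).
  elim: (wfL nu) => {}nu _ IHnu Inu; apply: IH => //=; first by rewrite addSnnS.
  move=> [|c' q] b w c p /= [].
    by move=> <- <- lt_c Ic; apply: IHnu.
  by move=> _; apply: Hu.
move=> p szp; apply: Pstep => // i e e' s' lt_i /(childP lt_i szp) /= [szs'].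
have [t def_tau] := cut_suffix p Iu; have [Itau _] := Cidx_cut (p ++ u).
rewrite def_tau in Itau *.
have suffix_nu q t' nu : Cidx C (nu :: t' ++ u) -> s' = q ++ nu :: t' ++ u -> P s'.
  case/lastP: t' => [|t' c] Inu def_s'.
    by rewrite def_s'; apply: Hnu; rewrite -?def_s'.
  move: Inu def_s'; rewrite cat_rcons => /(@Cidx_suffix (nu :: t')) Ic.
  by rewrite -cat_cons catA => def_s'; rewrite def_s'; apply: Hnu; rewrite -?def_s'.
case=> [[q [nu [def_s' Inu]]]|[q [t' [b [w [s0 [def_s' def_tu lt_s0 Is0]]]]]]].
  exact: suffix_nu Inu def_s'.
have [le_uw|lt_wu] := leqP (size u) (size w).
  have def_w : w = take (size w - size u) w ++ u.
    rewrite -[LHS](cat_take_drop (size w - size u)); congr (_ ++ _).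
    have := congr1 (drop (size t)) def_tu; rewrite drop_size_cat // => def_u.
    rewrite [RHS]def_u; have := congr1 size def_tu; rewrite !size_cat /= => sz.
    rewrite drop_cat ltnNge; have -> /= : (size t' <= size t)%N by lia.
    by have -> : (size t - size t' = (size w - size u).+1)%N by lia.
  by apply: (@suffix_nu q (take (size w - size u) w) s0); rewrite -def_w.
have [q' def_u] : exists q', u = q' ++ b :: w.
  have le_tq : (size t <= size t')%N.
    have := congr1 size def_tu; rewrite !size_cat /=; lia.
  exists (drop (size t) t').
  have := congr1 (drop (size t)) def_tu.
  rewrite drop_size_cat // drop_cat; case: ltnP => // le_t't -> /=.
  have -> : (size t - size t' = 0)%N by lia.
  by rewrite drop0 drop_oversize.
by rewrite def_s'; apply: Hu def_u lt_s0 Is0 _; rewrite -def_s'.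
Qed.

Lemma finite_Snode (a : L) (g : seq L) :
  well_founded (fun x y : L => (x < y)%O) -> size g = n ->
  finite_set (Snode C a g).
Proof.
move=> wfL szg; rewrite /Snode /Tr.
suff: forall e : int, finite_set [set x : seq 'I_n |
    foldl (fun o (i : 'I_n) => obind (child C a i) o) (Some (e, a :: g)) x != None].
  exact.
apply: (walk_ind (a := a) (P := fun s => forall e : int, finite_set [set x : seq 'I_n |
    foldl (fun o (i : 'I_n) => obind (child C a i) o) (Some (e, s)) x != None]))
  => //=; last by rewrite szg.
move=> s szs IH e.
pose T (i : 'I_n) : set (seq 'I_n) := [set x |
    foldl (fun o (i : 'I_n) => obind (child C a i) o) (child C a i (e, s)) x != None].
apply: (@sub_finite_set _ _ ([set [::]] `|` \bigcup_(i in setT) (cons i @` T i))).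
  by move=> [|i x] /= hx; [left | right; exists i => //; exists x].
rewrite finite_setU; split; first exact: finite_set1.
apply: bigcup_finite => // i _; apply: finite_image; rewrite /T.
case Ei: (child C a i (e, s)) => [[e' s']|]; first exact: IH Ei _.
rewrite [X in finite_set X](_ : _ = set0) //; apply/seteqP; split=> // x /=.
by have -> : foldl (fun o (i : 'I_n) => obind (child C a i) o) None x = None by elim: x.
Qed.

End Finiteness.

(* Main.v *)
(* For a finite sequence s of length n + 1 let D(s) be the alternating sum of the
   functions resh_n(., s^i), so that the alternating sum of the D(u^i) vanishes
   for all u.  If one step of the walk from (a, g) inserts nu in g, the recursion
   defining resh_n says that D(g with nu inserted), evaluated at a, is a basis
   element up to sign, which does not depend on a.

   Fix a limit ordinal e and work modulo functions constant on some (eta, e).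
   Applied to e followed by delta, the relation on D reduces the theorem to
   D(e, g) = 0 for e < g_0.  This is proved by induction along the walk from
   (e, g): inserting the same nu in (e, g) expresses D(e, g) by an insertion in a
   walk from below e and by the D(e, g') for the children g'.  The walks from
   (a, g) with a < e near e insert the same nu as the walk from (e, g), unless
   C_g is cofinal in e.  In that case C_g and C_e agree below e by coherence, and
   the walk from a inserts p(a) = min (C_e \ a).  The relation on D for
   (p(a), e, g) then requires D(p(a), e, g^i) = 0, which follows by a second
   induction of the same kind along the walk from (e, g^i). *)

Require Import Defs.
From mathcomp Require Import all_boot all_order all_algebra.
From mathcomp Require Import boolp classical_sets cardinality fsbigop.
From mathcomp Require Import finmap freeg zify.

Set Implicit Arguments.
Unset Strict Implicit.
Unset Printing Implicit Defensive.
Import Order.TTheory GRing.Theory.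
Local Open Scope classical_set_scope.
Local Open Scope ring_scope.

(** * Alternating sums over faces *)

Section Boundary.
Variables (T : Type) (V : zmodType).
Implicit Types (F : seq T -> V) (s : seq T).

Lemma del_cons l (x : T) s : del l.+1 (x :: s) = x :: del l s.
Proof. by []. Qed.

Lemma del_cat s1 (x : T) s2 : del (size s1) (s1 ++ x :: s2) = s1 ++ s2.
Proof.
rewrite /del take_size_cat // -cat_rcons drop_size_cat //.
by rewrite size_rcons.
Qed.

Lemma size_del l s : (l < size s)%N -> size (del l s) = (size s).-1.
Proof. by move=> ?; rewrite size_cat size_drop size_takel; lia. Qed.

(** The simplicial coboundary of the cochain [F]. D(s) is [boundary (resh C a) s], as a function of
    [a]. *)
Definition boundary F s : V := \sum_(i < size s) F (del i s) *~ (-1) ^+ i.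

Lemma boundaryE F m s : size s = m ->
  boundary F s = \sum_(i < m) F (del i s) *~ (-1) ^+ i.
Proof. by move=> <-. Qed.

Lemma boundary_cons F (x : T) s :
  boundary F (x :: s) = F s - boundary (fun t => F (x :: t)) s.
Proof.
rewrite /boundary /= big_ord_recl /= expr0 mulr1z /del take0 /= drop0.
congr (_ + _); rewrite -sumrN; apply: eq_bigr => i _.
by rewrite exprS mulN1r mulrNz.
Qed.

Lemma boundaryB F G s :
  boundary (fun t => F t - G t) s = boundary F s - boundary G s.
Proof. by rewrite /boundary -sumrB; apply: eq_bigr => i _; rewrite mulrzBl. Qed.

Lemma eq_boundary F G s : F =1 G -> boundary F s = boundary G s.
Proof. by move=> FG; apply: eq_bigr => i _; rewrite FG. Qed.

(** When both boundaries are expanded by the cone formula [boundary_cons], the terms [boundary F s]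
    cancel and the induction hypothesis for [fun t => F (x :: t)] remains. *)
Lemma boundary_boundary F s : boundary (boundary F) s = 0.
Proof.
elim: s F => [|x s IH] F; first by rewrite /boundary big_ord0.
rewrite boundary_cons (eq_boundary _ (boundary_cons F x)) boundaryB IH subr0.
by rewrite subrr.
Qed.

End Boundary.

(** * Steps of the walk as insertions into the sequence after [a] *)

Section Walks.
Context {d : Order.disp_t} {L : orderType d} {n : nat}.
Implicit Types (a b : L) (g s io tau : seq L).
Variable C : nCseq L n.

Definition least_above tau b : set L := fun nu =>
  [/\ Cseq C tau nu, (b <= nu)%O &
      forall x, Cseq C tau x -> (b <= x)%O -> (nu <= x)%O].

Lemma least_aboveP tau b nu :
  least_above tau b nu -> least (Cseq C tau `\` `]-oo, b[) = Some nu.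
Proof.
move=> [Cnu le_b nuP]; have nuL : ((Cseq C tau `\` `]-oo, b[) `&`
    lbound (Cseq C tau `\` `]-oo, b[)) nu.
  split; first by split=> //=; rewrite in_itv /=; apply/negP; rewrite -leNgt.
  by move=> x [Cx /=]; rewrite in_itv /= => /negP; rewrite -leNgt; exact: nuP.
rewrite /least; case: pselect => [h|]; last by case; exists nu.
case: (cid h) => nu' /= [[Cnu' nu'b] nu'P]; congr Some; apply/le_anti.
by rewrite nuL.2 // nu'P //; case: nuL.
Qed.

Lemma least_none tau b :
  (forall x, Cseq C tau x -> (x < b)%O) ->
  least (Cseq C tau `\` `]-oo, b[) = None.
Proof.
move=> ltb; rewrite /least; case: pselect => // h; exfalso; case: h => x [[Cx /= nx] _].
by case: nx; rewrite in_itv /=; apply: ltb.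
Qed.

(* [io ++ tau] is the decomposition of a sequence without its first entry, so
   that [io] is iota without its first entry. *)
Definition decomp io tau : Prop :=
  [/\ Cidx C tau, (size io + size tau = n)%N &
      forall q b, io = rcons q b -> ~ Cseq C tau b].

(** An earlier cut would make the suffix starting one entry before [tau] indexed: for empty [io] it
    has length [n.+1], and otherwise the last entry of [io] would lie in [Cseq C tau]. *)
Lemma cut_decomp a io tau : decomp io tau -> cut C (a :: io ++ tau) = (size io).+1.
Proof.
move=> [Itau sz nC]; apply/eqP; rewrite eqn_leq; apply/andP; split.
  rewrite leqNgt; apply/negP => lt_cut.
  have := before_find 0%N lt_cut; rewrite nth_iota /= ?size_cat; last by lia.
  by rewrite /= drop_size_cat // => /asboolP.
rewrite ltnNge; apply/negP => le_cut.
have [Icut _] := Cidx_cut C (a :: io ++ tau).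
have : Cidx C (drop (size io) (a :: io ++ tau)).
  move: Icut; set k := cut _ _ in le_cut *; rewrite -[drop k _](cat_take_drop (size io - k)).
  by rewrite drop_drop subnK // => /Cidx_suffix.
case/lastP: io sz nC {Icut le_cut} => [|q b] sz nC.
  by rewrite drop0 /= => /Cidx_inc[]; rewrite /= -sz ltnn.
rewrite size_rcons /= cat_rcons drop_size_cat // => /Cidx_tail[_].
exact: nC.
Qed.

Lemma child_none a i e io tau : decomp io tau ->
  (forall x, Cseq C tau x -> (x < last a io)%O) ->
  child C a i (e, a :: io ++ tau) = None.
Proof.
move=> dec ltb; rewrite /child (cut_decomp a dec) /= take_size_cat //.
by rewrite drop_size_cat //= least_none.
Qed.

Lemma child_some a i e io tau nu : decomp io tau ->
  least_above tau (last a io) nu ->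
  child C a i (e, a :: io ++ tau) =
    Some (e * (-1) ^+ (size io + (bump (size io) i).+1),
          a :: del (bump (size io) i) (io ++ nu :: tau)).
Proof.
move=> dec lnu; rewrite /child (cut_decomp a dec) /= take_size_cat //.
by rewrite drop_size_cat //= (least_aboveP lnu).
Qed.

Lemma decompP g : size g = n -> exists io tau, g = io ++ tau /\ decomp io tau.
Proof.
suff: (size g <= n)%N -> exists io tau, [/\ g = io ++ tau, Cidx C tau &
    forall q b, io = rcons q b -> ~ Cseq C tau b].
  move=> H sz; have [|io [tau [def_g Itau nC]]] := H; first by rewrite sz.
  by exists io, tau; split=> //; split=> //; rewrite -sz def_g size_cat.
elim: g => [|x g IH] sz; first by exists [::], [::]; split=> [//||[]//]; exact: Cidx_nil.
have [[|y io] [tau [def_g Itau nC]]] := IH (ltnW sz); last first.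
  exists (x :: y :: io), tau; split=> //; first by rewrite def_g.
  by move=> [|z q] b //= [_ def_io]; exact: nC def_io.
have [Cx|nCx] := pselect (Cseq C tau x).
  exists [::], (x :: g); split=> //; last by case.
  by rewrite def_g; apply/(Cidx_cons C _) => //; rewrite def_g in sz.
exists [:: x], tau; split=> //; first by rewrite def_g.
by move=> [|z [|]] b //= [<-].
Qed.

Hypothesis wfL : well_founded (fun x y : L => (x < y)%O).

Lemma least_above_ex tau b : (exists2 x, Cseq C tau x & (b <= x)%O) ->
  exists nu, least_above tau b nu.
Proof.
move=> [x + +]; elim: (wfL x) => {}x _ IH Cx le_bx.
have [[y [Cy le_by lt_yx]]|no] :=
    pselect (exists y, [/\ Cseq C tau y, (b <= y)%O & (y < x)%O]).
  exact: IH lt_yx Cy le_by.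
exists x; split=> // y Cy le_by; rewrite leNgt; apply/negP => lt_yx.
by apply: no; exists y.
Qed.

Lemma least_aboveVlt tau b : (exists nu, least_above tau b nu) \/
  (forall x, Cseq C tau x -> (x < b)%O).
Proof.
have [h|no] := pselect (exists2 x, Cseq C tau x & (b <= x)%O).
  by left; apply: least_above_ex.
right=> x Cx; rewrite ltNge; apply/negP => le_bx; apply: no.
by exists x.
Qed.

(** [walk_ind] for the sequences without their first entry [a]. Position [size io] is excluded
    because deleting [nu] gives back [io ++ tau]. *)
Lemma insertion_ind a (P : seq L -> Prop) :
  (forall io tau, decomp io tau ->
     (forall nu m, least_above tau (last a io) nu -> (m <= n)%N -> m != size io ->
        P (del m (io ++ nu :: tau))) ->
     P (io ++ tau)) ->
  forall g, size g = n -> P g.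
Proof.
move=> H g sz; have szs : size (a :: g) = n.+1 by rewrite /= sz.
have := @walk_ind _ _ _ C a (fun s => forall g', s = a :: g' -> P g') wfL _ _ szs g.
apply=> // s szs' IH g' def_s; rewrite def_s /= in szs'; case: szs' => szg'.
have [io [tau [def_g' dec]]] := decompP szg'; rewrite def_g'; apply: H => // nu m lnu le_m neq_m.
have [i lt_in <-] : exists2 i, (i < n)%N & bump (size io) i = m.
  by exists (unbump (size io) m); [rewrite /unbump; case: dec => _ *; lia|rewrite unbumpK].
by apply: (IH i 1 _ _ lt_in) erefl; rewrite def_s def_g' (child_some _ _ dec lnu).
Qed.

(** * The recursion for [resh] *)

Definition Tr_from a (p : option (int * seq L)) (x : seq 'I_n) :=
  foldl (fun o (i : 'I_n) => obind (child C a i) o) p x.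

Definition label_val (o : option (int * seq L)) : {freeg (seq L) / int} :=
  if o is Some (e, s) then << e *g drop 2 s >> else 0.

Lemma Tr_from_None a x : Tr_from a None x = None. Proof. by elim: x. Qed.

Lemma Tr_from_scale a e s x :
  Tr_from a (Some (e, s)) x = omap (fun p => (e * p.1, p.2)) (Tr_from a (Some (1, s)) x).
Proof.
have child_scale i e1 e2 s1 : child C a i (e1 * e2, s1) =
    omap (fun p => (e1 * p.1, p.2)) (child C a i (e2, s1)).
  by rewrite /child; case: least => //= nu; rewrite mulrA.
have: Some (e, s) = omap (fun p : int * seq L => (e * p.1, p.2)) (Some (1, s)).
  by rewrite /= mulr1.
elim: x (Some (e, s)) (Some (1, s)) => //= i x IH o1 o2 def_o1; apply: IH.
by rewrite def_o1; case: o2 {def_o1} => [[e2 s2]|//]; exact: child_scale.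
Qed.

Definition subtree_sum a (p : option (int * seq L)) : {freeg (seq L) / int} :=
  \sum_(x \in [set x | Tr_from a p x != None]) label_val (Tr_from a p x).

Lemma subtree_sum_scale a e g : size g = n ->
  subtree_sum a (Some (e, a :: g)) = resh C a g *~ e.
Proof.
move=> sz; rewrite /subtree_sum /resh.
have -> : [set x | Tr_from a (Some (e, a :: g)) x != None] = Snode C a g.
  by apply/seteqP; split=> x /=; rewrite Tr_from_scale /Snode /Tr /= /Tr_from; case: foldl.
rewrite !fsbig_finite; try exact: finite_Snode.
rewrite mulrz_suml; apply: eq_bigr => x _; rewrite Tr_from_scale /Tr /Tr_from.
by case: foldl => [[e' s]|] /=; rewrite ?mul0rz // freeg_mulz mulrzz mulrC.
Qed.

Lemma reshS a g : size g = n ->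
  resh C a g = << 1 *g behead g >> + \sum_(i < n) subtree_sum a (child C a i (1, a :: g)).
Proof.
move=> sz; pose A (i : 'I_n) := [set x | Tr_from a (child C a i (1, a :: g)) x != None].
have finS : finite_set (Snode C a g) by exact: finite_Snode.
have finA i : finite_set (A i).
  apply: (@finite_preimage _ _ (Snode C a g) (cons i)) => //.
  by move=> x y _ _ [].
pose r (i : 'I_n) : seq (seq 'I_n) := fset_set (A i).
have mem_r i x : x \in r i = (Tr_from a (child C a i (1, a :: g)) x != None).
  by rewrite /r in_fset_set //; apply/asboolP/idP.
(* The tree is listed as the root followed by the subtrees of its children. *)
rewrite /resh (fsbig_fwiden ([::] :: [seq i :: x | i <- enum 'I_n, x <- r i])).
- rewrite big_cons; congr (_ + _); first by rewrite /Tr /=; case: (g) => //= x t; rewrite drop0.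
  rewrite big_allpairs_dep /= big_enum /=; apply: eq_bigr => i _.
  rewrite /subtree_sum [RHS]fsbig_finite //; exact: finA.
- move=> [|i x] /= hx; rewrite inE //=; apply/allpairsPdep; exists i, x.
  by split; rewrite ?mem_enum ?mem_r.
- rewrite cons_uniq; apply/andP; split; first by apply/negP => /allpairsPdep[i [x []]].
  apply: allpairs_uniq_dep => [|i _|[i x] [j y] _ _ /= [-> ->] //].
    exact: enum_uniq.
  exact: fset_uniq.
- move=> x [/= _ /negP]; rewrite negbK => /eqP E.
  by rewrite /preimage /= E.
Qed.

Lemma resh_terminal a io tau : decomp io tau ->
  (forall x, Cseq C tau x -> (x < last a io)%O) ->
  resh C a (io ++ tau) = << 1 *g behead (io ++ tau) >>.
Proof.
move=> dec ltb; rewrite reshS ?size_cat; last by case: dec.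
rewrite big1 ?addr0 // => i _; rewrite (child_none _ _ dec ltb).
by apply: fsbig1 => x _; rewrite Tr_from_None.
Qed.

(** The face without [nu] is [io ++ tau]. The recursion for it gives the basis element and one term
    for each child; the children are the other faces, and the signs make these terms cancel. *)
Lemma boundary_resh a io tau nu : decomp io tau -> least_above tau (last a io) nu ->
  boundary (resh C a) (io ++ nu :: tau) =
  << 1 *g behead (io ++ tau) >> *~ (-1) ^+ size io.
Proof.
move=> dec lnu; have sz : (size io + size tau = n)%N by case: dec.
rewrite /boundary size_cat /= addnS sz.
have lt_io : (size io < n.+1)%N by lia.
rewrite (bigD1_ord (Ordinal lt_io)) //= del_cat reshS ?size_cat // mulrzDl -addrA.
rewrite -[RHS]addr0; congr (_ + _).
rewrite mulrz_suml -big_split big1 // => i _.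
rewrite (child_some _ _ dec lnu) subtree_sum_scale /=; last first.
  by rewrite size_del size_cat /= ?addnS ?sz // /bump; case: i => i /=; lia.
rewrite mul1r -mulrzA -mulrzDr; set b := bump _ _.
have -> : (-1) ^+ (size io + b.+1) * (-1) ^+ size io = - (-1) ^+ b :> int.
  by rewrite exprD exprS mulN1r mulrN mulNr mulrAC -expr2 sqrr_sign mul1r.
by rewrite addNr mulr0z.
Qed.

End Walks.

(** * Eventual constancy below [e] *)

Section Germs.
Context {d : Order.disp_t} {L : orderType d}.
Variables (e : L) (V : zmodType).
Implicit Types (P Q : L -> Prop) (f : L -> V).

Definition near_below P : Prop :=
  exists2 eta, (eta < e)%O & forall a, (eta < a < e)%O -> P a.

Lemma near_belowI P Q :
  near_below P -> near_below Q -> near_below (fun a => P a /\ Q a).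
Proof.
move=> [x lt_x HP] [y lt_y HQ]; exists (Order.max x y); first by rewrite gt_max lt_x.
by move=> a; rewrite gt_max -andbA => /and3P[xa ya ae]; split; [apply: HP|apply: HQ]; apply/andP.
Qed.

Lemma near_belowS P Q : (forall a, P a -> Q a) -> near_below P -> near_below Q.
Proof. by move=> PQ [x lt_x HP]; exists x => // a /HP/PQ. Qed.

Definition ev_constant f : Prop := exists c, near_below (fun a => f a = c).

Lemma ev_constant_eq f g : f =1 g -> ev_constant f -> ev_constant g.
Proof. by move=> fg [c fc]; exists c; apply: near_belowS fc => a; rewrite fg. Qed.

Lemma ev_constantMz f (z : int) : ev_constant f -> ev_constant (fun a => f a *~ z).
Proof. by move=> [c fc]; exists (c *~ z); apply: near_belowS fc => a ->. Qed.

Lemma ev_constant_sum (I : Type) (r : seq I) (p : pred I) (F : I -> L -> V) :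
  (exists x, (x < e)%O) -> (forall i, p i -> ev_constant (F i)) ->
  ev_constant (fun a => \sum_(i <- r | p i) F i a).
Proof.
move=> [x0 lt_x0] HF; elim: r => [|i r [c Hc]].
  by exists 0, x0 => // a _; rewrite big_nil.
have [pi|npi] := boolP (p i); last first.
  by apply: ev_constant_eq (ex_intro _ c Hc) => a; rewrite big_cons (negbTE npi).
have [c' Hc'] := HF i pi; exists (c' + c).
by apply: near_belowS (near_belowI Hc' Hc) => a [Ea Ea']; rewrite big_cons pi Ea Ea'.
Qed.

End Germs.

(** * Cofinal and bounded sets below an ordinal *)

Section Cofinality.
Context {d : Order.disp_t} {L : orderType d}.
Implicit Types (A B : set L) (b : L).

Definition cofinal_below A b : Prop :=
  forall c, (c < b)%O -> exists2 x, A x & (c < x < b)%O.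

Lemma cofinal_belowP A b : cofinal_below A b -> supremums (A `&` `]-oo, b[) b.
Proof.
move=> cof; split; first by move=> x [_]; rewrite /= in_itv => /ltW.
move=> c ubc; rewrite leNgt; apply/negP => /cof[x Ax /andP[cx xb]].
by have := ubc x; rewrite leNgt cx /= => /(_ (conj Ax _)); rewrite /= in_itv => /(_ xb).
Qed.

Lemma not_cofinal_below A b : ~ cofinal_below A b ->
  exists2 c, (c < b)%O & forall x, A x -> (x < b)%O -> (x <= c)%O.
Proof.
move=> ncof; apply: contrapT => no; apply: ncof => c lt_cb; apply: contrapT => no'.
apply: no; exists c => // x Ax xb; rewrite leNgt; apply/negP => cx.
by apply: no'; exists x; rewrite ?cx.
Qed.

Lemma cofinal_below_sub A B b : A `<=` B -> cofinal_below A b -> cofinal_below B b.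
Proof. by move=> AB cof c /cof[x /AB]; exists x. Qed.

End Cofinality.

(** * Order properties of the indices and the support of [resh] *)

Section Coherence.
Context {d : Order.disp_t} {L : orderType d} {n : nat}.
Implicit Types (a b t nu : L) (g s q io tau : seq L).
Variable C : nCseq L n.

Lemma decomp_last b io tau : Cidx C tau -> (size io + size tau).+1 = n ->
  ~ Cseq C tau (last b io) -> decomp C (b :: io) tau.
Proof.
move=> Itau sz nC; split=> // q c; rewrite lastI => /rcons_inj[_ <-] //.
Qed.

(** [Cseq C (t :: tau)] has the same strict upper bounds as the part of [Cseq C tau] below [t], so
    [Cseq C tau] has no element [x] with [b <= x < t]. Where the walk ends, this exhibits [t] as an
    inserted entry. *)
Lemma least_above_gap b t tau : Cidx C (t :: tau) -> (b < t)%O ->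
  (forall x, Cseq C (t :: tau) x -> (x < b)%O) ->
  ~ Cseq C tau b /\ least_above C tau b t.
Proof.
move=> It lt_bt ltb; have [Itau Ct] := Cidx_tail It.
have [_ ub _] := Cseq_club It.
have lt_b x : Cseq C tau x -> (x < t)%O -> (x < b)%O.
  move=> Cx xt; have: strict_ubound (Cseq C (t :: tau)) b by exact: ltb.
  by rewrite ub; apply; split=> //=; rewrite in_itv.
split; first by move/lt_b => /(_ lt_bt); rewrite ltxx.
split=> //; first exact: ltW.
move=> x Cx le_bx; rewrite leNgt; apply/negP => /(lt_b _ Cx).
by rewrite ltNge le_bx.
Qed.

Lemma Cseq_closed g b : Cidx C g -> (exists x, (x < b)%O) ->
  (exists2 x, Cseq C g x & (b <= x)%O) -> cofinal_below (Cseq C g) b -> Cseq C g b.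
Proof.
case: g => [|t g] Ig b_gt0 [x Cx le_bx] cof; first by rewrite Cseq_nil.
have [_ _ clo] := Cseq_club Ig; apply: clo => //; last exact: cofinal_belowP.
by have [? ?] := Cseq_sub Ig Cx; exists x => //; split=> //=; rewrite in_itv.
Qed.

Lemma sorted_Cseq nu tau : Cidx C tau -> Cseq C tau nu -> sorted <%O (nu :: tau).
Proof.
move=> Itau Cnu; have [_ [_]] := Cidx_inc Itau.
case: tau Itau Cnu => //= t tau It Cnu ->.
by have [_ ->] := Cseq_sub It Cnu.
Qed.

Lemma path_insert b io tau nu : path <%O b (io ++ tau) -> Cidx C tau ->
  Cseq C tau nu -> (last b io < nu)%O -> path <%O b (io ++ nu :: tau).
Proof.
rewrite !cat_path => /andP[-> _] Itau Cnu lt_nu /=.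
by rewrite lt_nu; exact: sorted_Cseq.
Qed.

Lemma sorted_del m s : sorted <%O s -> sorted <%O (del m s).
Proof.
apply: subseq_sorted; first exact: lt_trans.
rewrite -{2}(cat_take_drop m s) /del cat_subseq // -addn1 addnC -drop_drop.
exact: drop_subseq.
Qed.

Lemma least_above_lt b tau nu :
  ~ Cseq C tau b -> least_above C tau b nu -> (b < nu)%O.
Proof.
move=> nC [Cnu le_bnu _]; rewrite lt_neqAle le_bnu andbT.
by apply/eqP => E; rewrite E in nC.
Qed.

Lemma sorted_insert a io tau nu : decomp C io tau -> sorted <%O (io ++ tau) ->
  least_above C tau (last a io) nu -> sorted <%O (io ++ nu :: tau).
Proof.
move=> [Itau _ nC] srt lnu; have [Cnu _ _] := lnu.
case: io => [|x io] in nC srt lnu *; first exact: sorted_Cseq.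
apply: path_insert => //; apply: least_above_lt lnu.
exact: nC (lastI x io).
Qed.

Hypothesis wfL : well_founded (fun x y : L => (x < y)%O).

(** Induction along the walk: in [boundary_resh] every face except [io ++ tau] is an increasing
    child with coefficient 0 at [s], and the right-hand side is supported at an increasing
    sequence. *)
Lemma coeff_resh a g s : size g = n -> sorted <%O g -> ~ incseq n.-1 s ->
  coeff s (resh C a g) = 0.
Proof.
move: g; apply: (@insertion_ind _ _ _ C wfL a) => io tau dec IH srt ns.
have [_ sz _] := dec.
have coeff0 : coeff s (<< 1 *g behead (io ++ tau) >> : {freeg (seq L) / int}) = 0.
  rewrite coeffU; case: eqVneq => [E|]; last by rewrite mulr0.
  case: ns; split; first by rewrite -E size_behead size_cat sz.
  rewrite -E; case: (io ++ tau) srt => // x t; exact: path_sorted.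
have [[nu lnu]|lt_last] := least_aboveVlt C wfL tau (last a io); last first.
  by rewrite (resh_terminal wfL dec).
have lt_io : (size io < n.+1)%N by rewrite -sz ltnS leq_addr.
have /(congr1 (coeff s)) := boundary_resh wfL dec lnu.
rewrite (@boundaryE _ _ _ n.+1); last by rewrite size_cat /= addnS sz.
rewrite (bigD1 (Ordinal lt_io)) //= del_cat raddfMz /= coeff0 mul0rz raddfD raddf_sum /=.
rewrite [X in _ + X]big1 ?addr0 => [|i neq_i]; last first.
  rewrite raddfMz /= IH ?mul0rz //; first by rewrite -ltnS.
  by apply: sorted_del; exact: sorted_insert lnu.
by move/eqP; rewrite raddfMz /= -mulrzr mulf_eq0 intr_eq0 signr_eq0 orbF => /eqP.
Qed.

Hypothesis n_gt0 : (0 < n)%N.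
Hypothesis cohC : coherent C.

(** * Boundaries of [resh] modulo functions constant near [e] *)

Section Below.
Variable e : L.
Hypothesis e_gt0 : exists x, (x < e)%O.

(** The sequence may vary with [a], to allow for the entry p(a). *)
Definition negligible (u : L -> seq L) := ev_constant e (fun a => boundary (resh C a) (u a)).

(** The vanishing of the double boundary of [u a] is solved for the face [k]. *)
Lemma negligible_face m k (u : L -> seq L) : (forall a, size (u a) = m) -> (k < m)%N ->
  (forall i, (i < m)%N -> i != k -> negligible (fun a => del i (u a))) ->
  negligible (fun a => del k (u a)).
Proof.
move=> szu lt_km Hu.
pose S (a : L) := \sum_(i < m | i != Ordinal lt_km)
  boundary (resh C a) (del i (u a)) *~ (-1) ^+ i.
apply: (@ev_constant_eq _ _ _ _ (fun a => S a *~ - (-1) ^+ k)).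
  move=> a; have := boundary_boundary (resh C a) (u a).
  rewrite (boundaryE _ (szu a)) (bigD1 (Ordinal lt_km)) //= -/(S a) addrC => /eqP.
  rewrite addr_eq0 => /eqP ->.
  by rewrite mulNrz mulrNz opprK -mulrzA -expr2 sqrr_sign mulr1z.
apply/ev_constantMz/ev_constant_sum => // i neq_i.
by apply: ev_constantMz; apply: Hu.
Qed.

(** [nu] may vary with [a] since the value given by [boundary_resh] depends on [tau] only. *)
Lemma negligible_nil (nu : L -> L) tau : Cidx C tau -> size tau = n ->
  near_below e (fun a => least_above C tau a (nu a)) ->
  negligible (fun a => nu a :: tau).
Proof.
move=> Itau sz lnu; exists (<< 1 *g behead tau >> *~ (-1) ^+ 0%N).
apply: near_belowS lnu => a lnu; apply: (@boundary_resh _ _ _ C wfL a [::]) => //.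
by split=> // -[].
Qed.

(** Here [p a] may vary because [behead] removes it from the basis element. *)
Lemma negligible_cons (p : L -> L) io tau nu : Cidx C tau ->
  (size io + size tau).+1 = n ->
  near_below e (fun a => ~ Cseq C tau (last (p a) io) /\
                         least_above C tau (last (p a) io) nu) ->
  negligible (fun a => p a :: io ++ nu :: tau).
Proof.
move=> Itau sz lnu; exists (<< 1 *g io ++ tau >> *~ (-1) ^+ (size io).+1).
apply: near_belowS lnu => a [nC lnu].
by apply: (@boundary_resh _ _ _ C wfL a (p a :: io)) => //; exact: decomp_last.
Qed.

Lemma negligible_rcons q b tau nu : Cidx C tau -> (size q + size tau).+1 = n ->
  ~ Cseq C tau b -> least_above C tau b nu ->
  negligible (fun=> rcons q b ++ nu :: tau).
Proof.
have [x0 lt_x0] := e_gt0.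
case: q => [|x q] Itau sz nC lnu /=.
  by apply: (@negligible_cons (fun=> b) [::]) => //; exists x0.
apply: (@negligible_cons (fun=> x)) => //; first by rewrite size_rcons -addSn.
by exists x0 => // a _; rewrite last_rcons.
Qed.

(** The induction step for a nonempty iota ending with [b]: [nu] is inserted after [b]. The face
    without [p a] is settled by [negligible_rcons], which leaves the faces in the last premise. *)
Lemma negligible_insert (p : L -> L) q b tau : Cidx C tau ->
  (size q + size tau).+1 = n -> ~ Cseq C tau b -> sorted <%O (rcons q b ++ tau) ->
  (forall nu m, least_above C tau b nu -> (m <= n)%N -> m != (size q).+1 ->
     negligible (fun a => p a :: del m (rcons q b ++ nu :: tau))) ->
  negligible (fun a => p a :: rcons q b ++ tau).
Proof.
move=> Itau sz nC srt H; have [[nu lnu]|lt_b] := least_aboveVlt C wfL tau b.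
  have -> : (fun a => p a :: rcons q b ++ tau) =
      (fun a => del (size q).+2 (p a :: rcons q b ++ nu :: tau)).
    by apply/funext => a; rewrite -(del_cat _ nu) size_rcons.
  apply: (@negligible_face n.+2 _ (fun a => p a :: rcons q b ++ nu :: tau)).
  - by move=> a; rewrite /= size_cat size_rcons /=; lia.
  - by lia.
  move=> [|m] lt_m neq_m; last by apply: H => //; rewrite -ltnS.
  rewrite /del /= ?drop0; exact: negligible_rcons.
(* The walk ends here, but then [t] is the least element of [Cseq C tau] above
   [b], so that the sequence itself results from an insertion of [t]. *)
case: tau => [|t tau] in Itau sz nC srt lt_b {H} *.
  by have := lt_b b; rewrite Cseq_nil ltxx => /(_ I).
have lt_bt : (b < t)%O.
  by move: srt; rewrite cat_rcons => /(subseq_sorted lt_trans (suffix_subseq q _))/andP[].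
have [Itau' _] := Cidx_tail Itau; have [nCb lt] := least_above_gap Itau lt_bt lt_b.
apply: negligible_cons => //; first by rewrite size_rcons /= in sz *; lia.
have [x0 lt_x0] := e_gt0.
by exists x0 => // a _; rewrite last_rcons.
Qed.

Lemma negligible_ladder (p : L -> L) s : CX C e ->
  (forall a, (a < e)%O -> least_above C [:: e] a (p a)) ->
  size s = n -> head e s = e -> sorted <%O s ->
  negligible (fun a => p a :: s).
Proof.
move=> Xe pP; have [x0 lt_x0] := e_gt0.
have Ie : Cidx C [:: e] by apply/Cidx_cons => //; rewrite Cseq_nil; split=> //; exact: Cidx_nil.
have lt_pe a : (a < e)%O -> (p a < e)%O.
  by move=> /pP[/(Cseq_sub Ie)[]].
move: s; apply: (@insertion_ind _ _ _ C wfL e) => io tau dec IH; have [Itau sz nC] := dec.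
case/lastP: io => [|q b] in dec sz nC IH *.
  case: tau => [|t tau] /= in dec Itau sz nC IH * => def_t srt.
    by move: n_gt0; rewrite -sz.
  rewrite {t}def_t in dec Itau sz nC srt IH *.
  (* In the cofinal case coherence identifies [Cseq C (e :: tau)] with [Cseq C [:: e]], so the walk
     from [a] inserts [p a]. *)
  have [cof|] := pselect (cofinal_below (Cseq C (e :: tau)) e).
    apply: negligible_nil => //; exists x0 => // a /andP[_ lt_ae].
    have [_ coh2] := cohC Xe; rewrite /least_above coh2 //; first exact: pP.
    split=> [x Cx|c ubc]; first by have [_ /ltW] := Cseq_sub Itau Cx.
    by have [_] := cofinal_belowP cof; apply=> x [Cx _]; exact: ubc.
  (* For [a] above the bound [c], [Cseq C (e :: tau)] lies below [p a], so [e] itself is the entry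
     inserted after [p a]. *)
  move=> /not_cofinal_below[c lt_ce ubc].
  apply: (@negligible_cons p [::]) => //; first by have [] := Cidx_tail Itau.
  exists c => // a /andP[lt_ca lt_ae]; apply: least_above_gap => //; first exact: lt_pe.
  move=> x Cx; have [_ le_ap _] := pP a lt_ae; apply: lt_le_trans le_ap.
  by apply: le_lt_trans lt_ca; apply: ubc => //; have [] := Cseq_sub Itau Cx.
move=> hd srt; have nCb : ~ Cseq C tau b by exact: nC.
rewrite size_rcons in sz IH; rewrite last_rcons in IH.
apply: negligible_insert => // nu m lnu le_m neq_m.
have srt' : sorted <%O (rcons q b ++ nu :: tau).
  by apply: (@sorted_insert b) => //; rewrite last_rcons.
(* The induction hypothesis requires [e] in front; only the deletion at [m = 0] removes it. *)
case: m => [|m] in le_m neq_m *; last first.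
  apply: IH => //; last exact: sorted_del.
  by case: (q) hd.
(* If [q] is empty, then [b = e] is not in [Cseq C tau], which by closure is bounded below [e];
   hence near [e] the least element above [p a] is still [nu]. Otherwise [b] still precedes [nu]. *)
case: q => [|x q] /= in sz hd srt srt' {dec nC IH neq_m} *.
  rewrite hd in lnu nCb.
  have /not_cofinal_below[c lt_ce ubc] : ~ cofinal_below (Cseq C tau) e.
    move=> cof; apply: nCb; apply: Cseq_closed => //.
    by case: lnu => ? ? _; exists nu.
  rewrite /del /= ?drop0; apply: (@negligible_cons p [::]) => //.
  exists c => // a /andP[lt_ca lt_ae] /=; have [_ le_ap _] := pP a lt_ae.
  have lt_cp := lt_le_trans lt_ca le_ap.
  split; first by move=> /ubc /(_ (lt_pe a lt_ae)); rewrite leNgt lt_cp.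
  have [Cnu le_enu nuP] := lnu; split=> //; first exact: ltW (lt_le_trans (lt_pe a lt_ae) le_enu).
  move=> y Cy le_py; apply: nuP => //; rewrite leNgt; apply/negP => /(ubc y Cy).
  by rewrite leNgt (lt_le_trans lt_cp).
rewrite /del /= ?drop0; apply: negligible_cons => //; first by rewrite size_rcons -addSn.
by exists x0 => // a _; rewrite last_rcons.
Qed.

Lemma negligible_apex s : size s = n -> path <%O e s -> negligible (fun=> e :: s).
Proof.
have [x0 lt_x0] := e_gt0.
move: s; apply: (@insertion_ind _ _ _ C wfL e) => io tau dec IH; have [Itau sz nC] := dec.
case/lastP: io => [|q b] in dec sz nC IH *; last first.
  move=> srt; have nCb : ~ Cseq C tau b by exact: nC.
  rewrite size_rcons in sz IH; rewrite last_rcons in IH.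
  apply: (@negligible_insert (fun=> e)) => //; first exact: path_sorted srt.
  move=> nu m lnu le_m neq_m; apply: IH => //.
  have /sorted_del : sorted <%O (e :: rcons q b ++ nu :: tau).
    by apply: path_insert => //; rewrite ?last_rcons; [case: lnu|exact: least_above_lt lnu].
  by move=> /(_ m.+1).
rewrite /= in sz IH *.
case: tau => [|t tau] in Itau sz dec IH {nC} *; first by move: n_gt0; rewrite -sz.
move=> srt; have lt_et : (e < t)%O by case/andP: srt.
have [Itau' Ct] := Cidx_tail Itau.
have [cof|/not_cofinal_below[c lt_ce ubc]] := pselect (cofinal_below (Cseq C (t :: tau)) e).
  (* [Cseq C (t :: tau)] is closed only relative to [Cseq C tau], so [e] is first shown to be in the
     latter. *)
  have Ce : Cseq C (t :: tau) e.
    have [_ _ clo] := Cseq_club Itau; apply: clo => //; last exact: cofinal_belowP.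
    exists e => //; split; last by rewrite /= in_itv.
    apply: Cseq_closed => //; first by exists t => //; exact: ltW.
    by apply: cofinal_below_sub cof => x /(Cseq_sub Itau)[].
  have acc_e : acc (Cseq C (t :: tau)) e by split=> //; exact: cofinal_belowP.
  have Xe : CX C e by exists (t :: tau).
  have [coh1 _] := cohC Xe; have {coh1} Ceq := coh1 _ Itau sz acc_e.
  have /choice[p pP] : forall a, exists nu, (a < e)%O -> least_above C [:: e] a nu.
    move=> a; have [lt_ae|_] := boolP (a < e)%O; last by exists a.
    have [x Cx /andP[ax xe]] := cof a lt_ae.
    have [|nu lnu] := @least_above_ex _ _ _ C wfL [:: e] a; last by exists nu.
    by exists x; [rewrite -Ceq; split=> //=; rewrite in_itv | exact: ltW].
  (* Of the other faces, the one without [e] is an insertion by the walk from [a], and the rest,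
     which start with [p a] and [e], fall under [negligible_ladder]. *)
  apply: (@negligible_face n.+2 0 (fun a => p a :: e :: t :: tau)) => //.
    by move=> a; rewrite /= -sz.
  move=> [|[|i]] // lt_i _; last first.
    apply: (@negligible_ladder p (e :: del i (t :: tau))) => //.
      by rewrite /= size_del (sz : size (t :: tau) = n) ?prednK.
    by rewrite -del_cons; apply: sorted_del.
  apply: negligible_nil => //; exists x0 => // a /andP[_ lt_ae].
  have := pP a lt_ae; rewrite /least_above -Ceq => -[[Cp /=]].
  rewrite in_itv /= => lt_pe le_ap leastp; split=> // x Cx le_ax.
  have [lt_xe|] := ltP x e; last exact: le_trans (ltW lt_pe).
  by apply: leastp => //; split=> //=; rewrite in_itv.
have [[nu lnu]|lt_e] := least_aboveVlt C wfL (t :: tau) e; last first.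
  (* The walk from [e] ends at once, so [t] is itself an insertion into [e :: tau]. *)
  apply: (@negligible_cons (fun=> e) [::]) => //; exists x0 => // a _.
  exact: least_above_gap.
have near_nu : near_below e (fun a => least_above C (t :: tau) a nu).
  exists c => // a /andP[lt_ca lt_ae]; have [Cnu le_enu nuP] := lnu.
  split=> //; first exact: le_trans (ltW lt_ae) le_enu.
  move=> x Cx le_ax; apply: nuP => //; rewrite leNgt; apply/negP => /(ubc x Cx).
  by rewrite leNgt (lt_le_trans lt_ca).
have [E|neq_nu] := eqVneq nu e; first by rewrite E in near_nu; exact: negligible_nil near_nu.
have lt_enu : (e < nu)%O by rewrite lt_neqAle eq_sym neq_nu; case: lnu.
(* Without [e], the walks from below [e] insert [nu]; the faces keeping [e] and [nu] come from
   children of the walk from [e]. *)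
apply: (@negligible_face n.+2 1 (fun=> e :: nu :: t :: tau)) => //; first by rewrite /= -sz.
move=> [|[|i]] // lt_i _; first exact: negligible_nil near_nu.
rewrite del_cons; apply: IH => //.
have /sorted_del : sorted <%O (e :: nu :: t :: tau).
  by apply: (@path_insert _ [::]) => //; case: lnu.
by move=> /(_ i.+2).
Qed.

End Below.

Lemma resh_coherent : coherent_mod_lsc n (Phi_resh C).
Proof.
move=> d0 g [szs srt] e [_ _ e_gt0] le_e.
have [x0 lt_x0] := e_gt0.
suff [c [eta lt_eta cP]] : negligible e (fun=> d0 :: g).
  exists eta => // x y hx hy.
  by rewrite /Phi_resh -!(boundaryE _ szs) cP // cP.
have szg : size g = n by case: szs.
have [eq_e|neq_e] := eqVneq d0 e; first by subst d0; exact: negligible_apex.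
have lt_e : (e < d0)%O by rewrite lt_neqAle eq_sym neq_e.
apply: (@negligible_face e e_gt0 n.+2 0 (fun=> e :: d0 :: g)) => //.
  by rewrite /= szg.
move=> [|i] // lt_i _; rewrite del_cons; apply: negligible_apex => //.
  by rewrite size_del /= szg.
have /sorted_del : sorted <%O (e :: d0 :: g) by rewrite /= lt_e.
by move=> /(_ i.+1).
Qed.

End Coherence.

Theorem theoremB (d : Order.disp_t) (L : orderType d) (n : nat)
  (hn : (1 <= n)%N) (hL : is_cardinal L) (C : nCseq L n) (hC : coherent C) :
  n_family n (Phi_resh C) /\ coherent_mod_lsc n (Phi_resh C).
Proof.
have [wfL _] := hL; split; last exact: resh_coherent.
move=> g0 g [sz srt] a _ s; rewrite mem_dom => s_dom; apply: contrapT => ns.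
by move: s_dom; rewrite coeff_resh ?eqxx.
Qed.
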